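(* Suppose $f$ is ramified in $D$, so that $\mathfrak{F}=fD=P^2$ for a prime ideal $P$ of $D$. (i) If $d \equiv 1, 2\pmod 4$, or $d \equiv 3 \pmod 4$ and $f \ne 2$, then $P = fD+\sqrt{d}D$. If $d \equiv 3 \pmod 4$ and $f = 2$, then $P = 2D+ (1 + \sqrt{d})D$. (ii) Let $Q\subseteq \mathfrak{F}$ be a basic $\mathfrak{F}$-primary ideal of $O$. Then either $P^{4}\subsetneq Q\subseteq P^2$ or $P^{5} \subsetneq Q\subseteq P^3$. (iii) If $Q$ is an ideal of $O$ with $\mathfrak{F} \supsetneq Q \supsetneq \mathfrak{F}^2$, then either $Q = J_a = (f^2, f (a + \sqrt{d}))$ for some $a \in\{ 0, 1, \dots, f-1\}$, or $Q = J = (f, f^2 \sqrt{d}) = f O$. (iv) If $Q$ is an ideal of $O$ with $P^3 \supsetneq Q \supsetneq P^5 = f P^3$, then $Q = H_a = (f^3, a f^2 + f \sqrt{d})$ for some $a \in\{ 0, 1, \dots, f-1\}$, or $Q = (f^2, f^2 \sqrt{d}) = f \mathfrak{F} = P^4$, except when $f = 2$ and $d \equiv 3\pmod 4$; in this latter case, either $Q = (8, 2(1 + \sqrt{d}))$, or $Q = (8, 4 + 2(1 + \sqrt{d}))$, or $Q = (4, 4(1 + \sqrt{d})) = P^4$.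
   Context: Let $d$ be a square-free integer ($d\neq 1$), $K=\mathbb{Q}(\sqrt d)$ and $D=\mathbb{Z}[\omega]$ its ring of integers, where $\omega=\sqrt d$ if $d\equiv 2,3 \pmod 4$ and $\omega=(1+\sqrt d)/2$ if $d\equiv 1\pmod 4$. Let $f$ be a prime number and $O=\mathbb{Z}[f\omega]$, the unique order of $K$ with $[D:O]=f$. The conductor of $O$ is $\mathfrak{F}=\{x\in O: xD\subseteq O\}=fD$; it is a prime ideal of $O$. An ideal of $O$ is $\mathfrak{F}$-primary if it is primary with radical $\mathfrak{F}$; an $\mathfrak{F}$-primary ideal is basic if it is not contained in $\mathfrak{F}^2$. For $\alpha,\beta\in O$, $(\alpha,\beta)=\alpha O+\beta O$. *)

(* Defs.v *)
From mathcomp Require Import all_boot all_order all_algebra all_field.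
From mathcomp Require Import boolp classical_sets.

Set Implicit Arguments.
Unset Strict Implicit.
Unset Printing Implicit Defensive.

Import GRing.Theory.
Local Open Scope ring_scope.
Local Open Scope classical_set_scope.

(* The condition m = 0 forces d != 0, since 0 is not a unit. *)
Definition squarefree (d : int) : Prop :=
  forall m : int, (m ^+ 2 %| d)%Z -> m \is a GRing.unit.

(* Subrings of a field K and their ideals are represented as subsets of K, so
   that ideals of different subrings of K can be compared by inclusion. *)
Section SubsetsOfField.
Variable K : fieldType.
Implicit Types (A I J Q : set K) (a b x y : K).

Definition add_set I J : set K := [set x + y | x in I & y in J].

Definition dilate a I : set K := [set a * x | x in I].

(* The ideal (a, b) = aA + bA of the subring A. *)
Definition gen2 A a b : set K := add_set (dilate a A) (dilate b A).

Definition is_ideal A I : Prop :=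
  [/\ I `<=` A, I 0, (forall x y, I x -> I y -> I (x + y))
    & forall a x, A a -> I x -> I (a * x)].

(* The finite sums of products of an element of I by an element of J. *)
Definition ideal_mul I J : set K :=
  [set z | exists2 r : seq (K * K),
     (forall p, p \in r -> I p.1 /\ J p.2) & z = \sum_(p <- r) p.1 * p.2].

Fixpoint ideal_exp A I (n : nat) : set K :=
  if n is m.+1 then ideal_mul I (ideal_exp A I m) else A.

Definition prime_ideal A I : Prop :=
  [/\ is_ideal A I, I <> A
    & forall x y, A x -> A y -> I (x * y) -> I x \/ I y].

Definition radical A I : set K :=
  [set x | A x /\ exists2 n : nat, (0 < n)%N & I (x ^+ n)].

Definition primary_ideal A Q : Prop :=
  [/\ is_ideal A Q, Q <> A
    & forall x y, A x -> A y -> Q (x * y) -> Q x \/ radical A Q y].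

(* Q is I-primary. *)
Definition primary_to A I Q : Prop := primary_ideal A Q /\ radical A Q = I.

Definition basic_primary A I Q : Prop :=
  primary_to A I Q /\ ~ (Q `<=` ideal_exp A I 2).

(* The conductor of the subring A in the overring B. *)
Definition conductor A B : set K :=
  [set x | A x /\ forall y, B y -> A (x * y)].

Definition Zadjoin x : set K :=
  [set y | exists p : {poly int}, y = (map_poly intr p).[x]].

Definition ring_of_integers : set K := [set x | integralOver (intr : int -> K) x].

(* The generator of the ring of integers of Q(sqrt d), where s = sqrt d. *)
Definition omega (d : int) (s : K) : K :=
  if (d == 1 %[mod 4])%Z then (1 + s) / 2 else s.

End SubsetsOfField.

Arguments ring_of_integers : clear implicits.

(* Main.v *)
Require Import Defs.
From mathcomp Require Import all_boot all_order all_algebra all_field.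
From mathcomp Require Import boolp classical_sets.
From mathcomp Require Import zify ring.

Set Implicit Arguments.
Unset Strict Implicit.

Import GRing.Theory.
Local Open Scope ring_scope.
Local Open Scope classical_set_scope.

(** Since f ramifies, the maximal order D is generated over the integers by a
    root pi of a polynomial X^2 - T X + N that is Eisenstein at f, namely
    (f + s) / 2, s or 1 + s (exists_eisenstein_generator).  Writing
    [u, v] = Zu + Zv, one gets D = [1, pi], O = [1, f pi] and P = [f, pi]
    (ring_of_integersE, ZadjoinE, ramified_primeE).  The hypothesis P^2 = fD
    yields P^3 = fP, P^4 = f^2 D and P^5 = f^2 P, and the conductor is
    F = fD with F^2 = f^2 D.

    (i) The lattice [f, pi] is generated over D by f and any element
    c pi + e f with c prime to f; s or 1 + s has this form, with c = 1 or 2.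

    (ii) Let f y be an element of Q outside P^3, respectively outside P^4 when
    Q lies in P^3.  Then y is a unit, respectively a uniformizer, at P, which
    is seen on its norm.  Some power f^n lies in Q because F is the radical of
    Q, and Bezout's identity between f^n and the norm of y (divided by f in the
    second case) shows that Q contains P^4, respectively P^5.

    (iii), (iv) The pairs F, F^2 and P^3, P^5 have the form L, fL for a lattice
    L = [u, v] stable under pi.  Every additive group between fL and L is
    an ideal of O, as f pi L lies in fL; the proper ones are the lines of the
    plane L / fL over the field with f elements, that is the line of u and the
    f lines of a u + w for a fixed w independent of u
    (exists_line_generator, line_sub, intermediate_ideals). *)

(** * Lattices of rank two and their sublattices of prime index *)

Lemma prime_dvdzM (f : nat) (a b : int) : prime f ->
  (f %| a * b)%Z = (f %| a)%Z || (f %| b)%Z.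
Proof. by move=> pf; rewrite !dvdzE abszM Euclid_dvdM. Qed.

Lemma prime_coprimez (f : nat) (a : int) : prime f ->
  coprimez a f = ~~ (f %| a)%Z.
Proof. by move=> pf; rewrite coprimezE coprime_sym prime_coprime. Qed.

Section Lattices.
Variable K : fieldType.
Implicit Types (A I J M N : set K) (u v w x y z : K).

(** The combinations of two elements, rather than differences, make it
    possible to check membership by one explicit identity. *)
Definition Zclosed M : Prop :=
  forall (a b : int) x y, M x -> M y -> M (a%:~R * x + b%:~R * y).

Definition Zspan u v : set K :=
  [set x | exists a b : int, x = a%:~R * u + b%:~R * v].

Definition Zfree u v : Prop :=
  forall a b : int, a%:~R * u + b%:~R * v = 0 -> a = 0 /\ b = 0.

Lemma Zclosed_scale M (a : int) x : Zclosed M -> M x -> M (a%:~R * x).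
Proof. by move=> cM Mx; have := cM a 0 x x Mx Mx; rewrite mul0r addr0. Qed.

Lemma Zclosed_add M x y : Zclosed M -> M x -> M y -> M (x + y).
Proof. by move=> cM Mx My; have := cM 1 1 x y Mx My; rewrite !mul1r. Qed.

(** Bezout; this replaces every division by an integer prime to f. *)
Lemma Zclosed_coprime M (a b : int) x : Zclosed M -> coprimez a b ->
  M (a%:~R * x) -> M (b%:~R * x) -> M x.
Proof.
move=> cM /coprimezP[[p q] /= e] Max Mbx.
have -> : x = p%:~R * (a%:~R * x) + q%:~R * (b%:~R * x).
  by rewrite !mulrA -mulrDl -!intrM -intrD e mul1r.
exact: cM.
Qed.

Lemma Zclosed_Zspan u v : Zclosed (Zspan u v).
Proof.
move=> a b _ _ [x1 [y1 ->]] [x2 [y2 ->]].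
by exists (a * x1 + b * x2), (a * y1 + b * y2); ring.
Qed.

Lemma Zspan_l u v : Zspan u v u. Proof. by exists 1, 0; ring. Qed.

Lemma Zspan_r u v : Zspan u v v. Proof. by exists 0, 1; ring. Qed.

Lemma Zspan_sub M u v : Zclosed M -> M u -> M v -> Zspan u v `<=` M.
Proof. by move=> cM Mu Mv _ [a [b ->]]; apply: cM. Qed.

Lemma Zspan_shift u v (j : int) : Zspan u (v + j%:~R * u) = Zspan u v.
Proof.
apply/seteqP; split; apply: Zspan_sub.
- exact: Zclosed_Zspan.
- exact: Zspan_l.
- by exists j, 1; ring.
- exact: Zclosed_Zspan.
- exact: Zspan_l.
- by exists (- j), 1; ring.
Qed.

Lemma dilate_Zspan c u v : dilate c (Zspan u v) = Zspan (c * u) (c * v).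
Proof.
apply/seteqP; split=> [_ [_ [a [b ->]] <-]|_ [a [b ->]]].
  by exists a, b; ring.
by exists (a%:~R * u + b%:~R * v); [exists a, b | ring].
Qed.

Lemma Zfree_inj u v (a b a' b' : int) : Zfree u v ->
  a%:~R * u + b%:~R * v = a'%:~R * u + b'%:~R * v -> a = a' /\ b = b'.
Proof.
move=> fr e; have [] : a - a' = 0 /\ b - b' = 0.
  apply: fr; rewrite -[RHS](subrr (a'%:~R * u + b'%:~R * v)) -{1}e.
  by ring.
by move=> /eqP; rewrite subr_eq0 => /eqP-> /eqP; rewrite subr_eq0 => /eqP->.
Qed.

Lemma Zclosed_ideal A I :
  is_ideal A I -> (forall n : int, A n%:~R) -> Zclosed I.
Proof. by case=> _ _ addI mulI ZA a b x y Ix Iy; apply: addI; apply: mulI. Qed.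

Section PrimeIndex.
Variables (f : nat) (u v : K).
Hypotheses (pf : prime f) (fr : Zfree u v).

Local Notation fL := (Zspan (f%:R * u) (f%:R * v)).

Lemma Zspan_dilateP (a b : int) :
  fL (a%:~R * u + b%:~R * v) <-> (f %| a)%Z /\ (f %| b)%Z.
Proof.
split=> [[p [q e]]|[/dvdzP[p ->] /dvdzP[q ->]]]; last by exists p, q; ring.
have [] : a = p * f /\ b = q * f by apply: (Zfree_inj fr); rewrite e; ring.
by move=> -> ->; rewrite !dvdz_mull.
Qed.

(** The intermediate group M corresponds to a nonzero subspace of the plane
    L / fL over the field with f elements.  A nonzero vector of M is, up to a
    scalar, either u or has second coordinate c; as c is invertible mod f, any
    w = e u + c v outside the line of u can serve as origin of the affine line
    of the vectors a u + w. *)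
Lemma exists_line_generator M (c e : int) :
  Zclosed M -> M `<=` Zspan u v -> fL `<=` M -> ~ (M `<=` fL) ->
  coprimez c f ->
  M u \/ exists2 a : nat, (a < f)%N & M (a%:R * u + (e%:~R * u + c%:~R * v)).
Proof.
move=> cM ML fLM /existsNP[x /not_implyP[Mx nx]] cf.
have [al [be xE]] := ML _ Mx; rewrite {}xE in Mx nx.
have Mfu : M (f%:R * u) by apply: fLM; apply: Zspan_l.
have Mfv : M (f%:R * v) by apply: fLM; apply: Zspan_r.
have [fb|nfb] := boolP (f %| be)%Z.
  left; have nfa : ~~ (f %| al)%Z.
    by apply/negP=> fa; apply: nx; apply/Zspan_dilateP.
  apply: (@Zclosed_coprime _ al f) => //; first by rewrite prime_coprimez.
  have [q qE] := dvdzP fb.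
  have -> : al%:~R * u = 1%:~R * (al%:~R * u + be%:~R * v)
       + (- q)%:~R * (f%:R * v) by rewrite qE; ring.
  exact: cM.
(* p * c rescales the second coordinate be to c, up to a multiple of f. *)
right; move: nfb; rewrite -prime_coprimez // => /coprimezP[[p q] /= bez].
pose a := ((p * c * al - e) %% f)%Z.
have f_gt0 := prime_gt0 pf.
have a_ge0 : 0 <= a by rewrite modz_ge0 // -lt0n.
have a_lt : a < f by rewrite ltz_pmod.
exists `|a|%N; first by lia.
have aE : (`|a|%N)%:R = a%:~R :> K by rewrite -[in RHS](gez0_abs a_ge0).
pose k := ((p * c * al - e) %/ f)%Z.
have kE : p * c * al - e = k * f + a by rewrite -divz_eq.
rewrite aE.
have -> : a%:~R * u + (e%:~R * u + c%:~R * v) =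
    (p * c)%:~R * (al%:~R * u + be%:~R * v)
     + 1%:~R * ((- k)%:~R * (f%:R * u) + (c * q)%:~R * (f%:R * v)).
  have -> : a = p * c * al - e - k * f by rewrite kE; ring.
  have cE : c = c * (p * be + q * f) by rewrite bez mulr1.
  by rewrite {2}cE; ring.
by apply: (cM); last apply: (cM).
Qed.

(** Two lines of the plane L / fL that share a nonzero vector x coincide: the
    determinant of x and any y in M annihilates L / M, so it vanishes mod f
    because M is not L, and then y is proportional to x mod f. *)
Lemma line_sub M N x : Zclosed M -> Zclosed N ->
  fL `<=` M -> fL `<=` N -> M `<=` Zspan u v -> ~ (Zspan u v `<=` M) ->
  M x -> N x -> ~ fL x -> M `<=` N.
Proof.
move=> cM cN fM fN ML nM Mx Nx nx.
have [al [be xE]] := ML _ Mx; rewrite {}xE in Mx Nx nx.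
have fu : fL (f%:R * u) by exact: Zspan_l.
have fv : fL (f%:R * v) by exact: Zspan_r.
move=> y My; have [ga [de yE]] := ML _ My; rewrite {}yE in My *.
set X := al%:~R * u + be%:~R * v in Mx Nx nx.
set Y := ga%:~R * u + de%:~R * v in My *.
pose Dl := al * de - be * ga.
have [fD|nfD] := boolP (f %| Dl)%Z; last first.
  rewrite -prime_coprimez // in nfD.
  case: nM; apply: Zspan_sub => //; apply: (@Zclosed_coprime _ Dl f) => //.
  - have -> : Dl%:~R * u = de%:~R * X + (- be)%:~R * Y.
      by rewrite /X /Y /Dl; ring.
    exact: cM.
  - exact: fM.
  - have -> : Dl%:~R * v = al%:~R * Y + (- ga)%:~R * X.
      by rewrite /X /Y /Dl; ring.
    exact: cM.
  - exact: fM.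
have [q qE] := dvdzP fD.
have Nf : N (f%:R * Y).
  by apply: fN; exists ga, de; rewrite /Y; ring.
have [fa|nfa] := boolP (f %| al)%Z.
  have nfb : ~~ (f %| be)%Z.
    by apply/negP=> fb; apply: nx; apply/Zspan_dilateP.
  apply: (@Zclosed_coprime _ be f) => //; first by rewrite prime_coprimez.
  have -> : be%:~R * Y = de%:~R * X + (- q)%:~R * (f%:R * u).
    have -> : (- q)%:~R * (f%:R * u) = (- (q * f))%:~R * u by ring.
    by rewrite -qE /X /Y /Dl; ring.
  by apply: cN => //; apply: fN.
apply: (@Zclosed_coprime _ al f) => //; first by rewrite prime_coprimez.
have -> : al%:~R * Y = ga%:~R * X + q%:~R * (f%:R * v).
  have -> : q%:~R * (f%:R * v) = (q * f)%:~R * v by ring.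
  by rewrite -qE /X /Y /Dl; ring.
by apply: cN => //; apply: fN.
Qed.

End PrimeIndex.

Lemma gen2P A a b x : gen2 A a b x <->
  exists2 p, A p & exists2 q, A q & x = a * p + b * q.
Proof.
split=> [[_ [p Ap <-] [_ [q Aq <-] <-]]|[p Ap [q Aq ->]]].
  by exists p => //; exists q.
by exists (a * p); [exists p|exists (b * q) => //; exists q].
Qed.

Lemma gen2_sub A I a b : is_ideal A I -> I a -> I b -> gen2 A a b `<=` I.
Proof.
move=> [_ _ addI mulI] Ia Ib x /gen2P[p Ap [q Aq ->]].
by apply: addI; rewrite mulrC; apply: mulI.
Qed.

Lemma Zclosed_gen2 A a b : Zclosed A -> Zclosed (gen2 A a b).
Proof.
move=> cA m n _ _ /gen2P[p Ap [q Aq ->]] /gen2P[p' Ap' [q' Aq' ->]].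
apply/gen2P; exists (m%:~R * p + n%:~R * p'); first exact: cA.
exists (m%:~R * q + n%:~R * q'); first exact: cA.
by ring.
Qed.

End Lattices.

(** * Products and powers of ideals *)

Section IdealProducts.
Variable K : fieldType.
Implicit Types (A I J M : set K) (c x y z : K).

(** Universal property of the product; it avoids handling finite sums. *)
Lemma ideal_mul_sub I J M : M 0 ->
  (forall x y, M x -> M y -> M (x + y)) ->
  (forall x y, I x -> J y -> M (x * y)) -> ideal_mul I J `<=` M.
Proof.
move=> M0 addM prodM _ [r rIJ ->]; rewrite big_seq.
by apply: big_ind => // p /rIJ[Ip Jp]; apply: prodM.
Qed.

Lemma ideal_mul_prod I J x y : I x -> J y -> ideal_mul I J (x * y).
Proof.
move=> Ix Jy; exists [:: (x, y)]; last by rewrite big_seq1.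
by move=> p; rewrite inE => /eqP ->.
Qed.

Lemma ideal_mul0 I J : ideal_mul I J 0.
Proof. by exists [::]; rewrite ?big_nil. Qed.

Lemma ideal_mulD I J x y :
  ideal_mul I J x -> ideal_mul I J y -> ideal_mul I J (x + y).
Proof.
move=> [r rP ->] [r' rP' ->]; exists (r ++ r'); last by rewrite big_cat.
by move=> p; rewrite mem_cat => /orP[/rP|/rP'].
Qed.

Lemma ideal_mul_dilate I J c :
  ideal_mul I (dilate c J) = dilate c (ideal_mul I J).
Proof.
apply/seteqP; split.
  apply: ideal_mul_sub.
  - by exists 0; [exact: ideal_mul0 | rewrite mulr0].
  - move=> _ _ [x Ix <-] [y Iy <-]; exists (x + y); last by rewrite mulrDr.
    exact: ideal_mulD.
  - move=> x _ Ix [y Jy <-]; exists (x * y); last by rewrite mulrCA.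
    exact: ideal_mul_prod.
move=> _ [_ [r rIJ ->] <-].
rewrite big_distrr big_seq; apply: big_ind => [||p /rIJ[Ip Jp]].
- exact: ideal_mul0.
- by move=> x y; apply: ideal_mulD.
- by rewrite /= mulrCA; apply: ideal_mul_prod => //; exists p.2.
Qed.

Lemma ideal_mulr A I : is_ideal A I -> A 1 -> ideal_mul I A = I.
Proof.
move=> [_ I0 addI mulI] A1; apply/seteqP; split=> [|x Ix].
  by apply: ideal_mul_sub => // x a Ix Aa; rewrite mulrC; apply: mulI.
by rewrite -[x]mulr1; apply: ideal_mul_prod.
Qed.

Lemma dilate_ideal A I c : is_ideal A I -> A c -> is_ideal A (dilate c I).
Proof.
move=> [IA I0 addI mulI] Ac; split.
- by move=> _ [x Ix <-]; apply/IA/mulI.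
- by exists 0; rewrite ?mulr0.
- move=> _ _ [x Ix <-] [y Iy <-]; exists (x + y); last by rewrite mulrDr.
  exact: addI.
- move=> a _ Aa [x Ix <-]; exists (a * x); last by rewrite mulrCA.
  exact: mulI.
Qed.

(** As the square of P is cA, the powers of P are known from P and A alone:
    multiplying by P twice amounts to dilating by c. *)
Section PowersOverSquareRoot.
Variables (A P : set K) (c : K).
Hypotheses (A1 : A 1) (idP : is_ideal A P).
Hypothesis P2 : dilate c A = ideal_exp A P 2.

Lemma ideal_mul_self : ideal_mul P P = dilate c A.
Proof. by rewrite P2 /= (ideal_mulr idP). Qed.

Lemma ideal_exp3 : ideal_exp A P 3 = dilate c P.
Proof.
by rewrite -[LHS]/(ideal_mul P (ideal_exp A P 2)) -P2 ideal_mul_dilate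
   ideal_mulr.
Qed.

Lemma ideal_exp4 : ideal_exp A P 4 = dilate c (dilate c A).
Proof.
by rewrite -[LHS]/(ideal_mul P (ideal_exp A P 3)) ideal_exp3 ideal_mul_dilate
   ideal_mul_self.
Qed.

Lemma ideal_exp5 : ideal_exp A P 5 = dilate c (ideal_exp A P 3).
Proof.
by rewrite -[LHS]/(ideal_mul P (ideal_exp A P 4)) ideal_exp4 !ideal_mul_dilate
   ideal_mulr // ideal_exp3.
Qed.

End PowersOverSquareRoot.

End IdealProducts.

(** * Orders generated by a root of an Eisenstein polynomial *)

(** The polynomial X^2 - T X + N satisfied by pi is Eisenstein at f, which is
    what total ramification of f amounts to.  In these coordinates the maximal
    order D, the order O of index f and the prime P above f are the lattices
    spanned by (1, pi), (1, f pi) and (f, pi). *)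
Section EisensteinOrder.
Variables (K : fieldType) (pi : K) (T N : int) (f : nat).
Hypotheses (pf : prime f) (fr : Zfree 1 pi).
Hypothesis pi2 : pi * pi = T%:~R * pi - N%:~R.
Hypotheses (fT : (f %| T)%Z) (fN : (f %| N)%Z) (nfN : ~~ (f * f %| N)%Z).

Local Notation fK := (f%:R : K).
Local Notation D := (Zspan 1 pi).
Local Notation O := (Zspan 1 (fK * pi)).
Local Notation P := (Zspan fK pi).

Lemma order_mul x y : D x -> D y -> D (x * y).
Proof.
move=> [a [b ->]] [a' [b' ->]].
exists (a * a' - b * b' * N), (a * b' + b * a' + b * b' * T).
transitivity (a%:~R * a'%:~R + (a * b' + b * a')%:~R * pi
              + (b * b')%:~R * (pi * pi)); first by ring.
by rewrite pi2; ring.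
Qed.

Lemma order_int (n : int) : D n%:~R. Proof. by exists n, 0; ring. Qed.

Lemma suborder_int (n : int) : O n%:~R. Proof. by exists n, 0; ring. Qed.

Lemma order1 : D 1. Proof. exact: Zspan_l. Qed.

Lemma order_f : D fK. Proof. exact: (order_int f). Qed.

Lemma order_ideal : is_ideal D D.
Proof.
split=> //; first exact: (order_int 0); last exact: order_mul.
by move=> x y; apply: Zclosed_add; apply: Zclosed_Zspan.
Qed.

Lemma suborder_sub : O `<=` D.
Proof.
apply: Zspan_sub; first exact: Zclosed_Zspan; first exact: Zspan_l.
by exists 0, f; ring.
Qed.

Lemma suborder_dilate x : D x -> O (fK * x).
Proof.
by move=> [a [b ->]]; exists (a * f), b; ring.
Qed.

Lemma Zfree_dilate (c u v : K) : c != 0 -> Zfree u v -> Zfree (c * u) (c * v).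
Proof.
move=> c0 fuv a b e; apply: fuv; apply: (mulfI c0); rewrite mulr0 -e; ring.
Qed.

Lemma fK_neq0 : fK != 0.
Proof.
apply/eqP=> f0; have [] : (f : int) = 0 /\ (0 : int) = 0.
  by apply: fr; rewrite mul0r addr0 mulr1; exact: f0.
by move=> e _; move: (prime_gt0 pf); rewrite -ltz_nat e.
Qed.

Lemma Zfree_P : Zfree fK pi.
Proof.
move=> a b e; have [] : a * f = 0 /\ b = 0.
  by apply: fr; rewrite -e; ring.
move=> /eqP; rewrite mulf_eq0 => /orP[/eqP->|/eqP e0] //.
by move: (prime_gt0 pf); rewrite -ltz_nat e0.
Qed.

(** The coefficient of pi in x pi must be divisible by f, and this forces f
    to divide the constant coefficient of x. *)
Lemma conductorE : conductor O D = dilate fK D.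
Proof.
apply/seteqP; split=> [x [Ox xD]|x [y Dy <-]].
  have [a [b xE]] := Ox; have [p [q]] := xD _ (Zspan_r _ _).
  have -> : x * pi = (- (b * f * N))%:~R * 1 + (a + b * f * T)%:~R * pi.
    transitivity (a%:~R * pi + (b * f)%:~R * (pi * pi)).
      by rewrite xE; ring.
    by rewrite pi2; ring.
  have -> : p%:~R * 1 + q%:~R * (fK * pi) = p%:~R * 1 + (q * f)%:~R * pi.
    by ring.
  case/(Zfree_inj fr) => _ e; rewrite xE.
  have -> : a = (q - b * T) * f by rewrite mulrBl -e; ring.
  exists ((q - b * T)%:~R * 1 + b%:~R * pi); last by ring.
  by exists (q - b * T), b.
split; first exact: suborder_dilate.
move=> z Dz; rewrite -mulrA; apply: suborder_dilate; exact: order_mul.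
Qed.

(** P' contains f D, hence f, and the square of pi, hence pi, as the
    polynomial of pi is X^2 mod f.  The lattice spanned by f and pi has prime
    index in D, so it is all of P'. *)
Lemma ramified_primeE (P' : set K) :
  prime_ideal D P' -> dilate fK D = ideal_exp D P' 2 -> P' = P.
Proof.
move=> [idP nP prP] P2.
have [PD _ _ mulP] := idP.
have ZP : Zclosed P' := Zclosed_ideal idP order_int.
have fDP : dilate fK D `<=` P'.
  rewrite P2 /= (ideal_mulr idP order1); apply: ideal_mul_sub.
  - by case: idP.
  - by case: idP.
  - by move=> x y /PD Dx; apply: mulP.
have fP : P' fK by apply: fDP; exists 1; [exact: order1 | rewrite mulr1].
have piP : P' pi.
  suff: P' (pi * pi) by case/(prP _ _ (Zspan_r _ _) (Zspan_r _ _)).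
  have [t tE] := dvdzP fT; have [n nE] := dvdzP fN.
  apply: fDP; exists (t%:~R * pi - n%:~R); last by rewrite pi2 tE nE; ring.
  by exists (- n), t; ring.
apply/seteqP; split; last exact: Zspan_sub.
move=> x Px; have [a [b xE]] := PD _ Px.
have [/dvdzP[q qE]|nfa] := boolP (f %| a)%Z.
  by exists q, b; rewrite xE qE; ring.
case: nP; apply/seteqP; split=> // y Dy.
rewrite -[y]mulr1; apply: mulP => //.
apply: (@Zclosed_coprime _ _ a f) => //; first by rewrite prime_coprimez.
  have -> : a%:~R * 1 = 1%:~R * x + (- b)%:~R * pi by rewrite xE; ring.
  exact: ZP.
by rewrite mulr1.
Qed.

Lemma gen2_P (c e : int) : coprimez c f ->
  gen2 D fK (c%:~R * pi + e%:~R * fK) = P.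
Proof.
move=> cf; set g := _ + _.
have cG : Zclosed (gen2 D fK g) by apply: Zclosed_gen2; apply: Zclosed_Zspan.
have fG x : D x -> gen2 D fK g (fK * x).
  move=> Dx; apply/gen2P; exists x => //; exists 0; first exact: (order_int 0).
  by ring.
have gG : gen2 D fK g g.
  apply/gen2P; exists 0; first exact: (order_int 0).
  by exists 1; [exact: order1 | ring].
have idP : is_ideal D P.
  have [t tE] := dvdzP fT; have [n nE] := dvdzP fN.
  split.
  - apply: Zspan_sub; [exact: Zclosed_Zspan | exact: order_f |].
    exact: Zspan_r.
  - by exists 0, 0; ring.
  - by move=> x y; apply: Zclosed_add; apply: Zclosed_Zspan.
  move=> _ _ [p [q ->]] [a [b ->]].
  exists (p * a - q * b * n), (p * b + q * a * f + q * b * T).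
  transitivity ((p * a)%:~R * fK + (p * b + q * a * f)%:~R * pi
                + (q * b)%:~R * (pi * pi)); first by ring.
  by rewrite pi2 nE; ring.
apply/seteqP; split.
  apply: gen2_sub => //; first exact: Zspan_l.
  by exists e, c; rewrite /g; ring.
apply: Zspan_sub => //; first by have := fG 1 order1; rewrite mulr1.
apply: (@Zclosed_coprime _ _ c f) => //.
  have -> : c%:~R * pi = 1%:~R * g + (- e)%:~R * (fK * 1) by rewrite /g; ring.
  by apply: cG => //; apply: fG; exact: order1.
by apply: fG; exact: Zspan_r.
Qed.

Lemma order_ideal_pi M : is_ideal D M -> forall x, M x -> M (pi * x).
Proof. by case=> _ _ _ mulM x; apply: mulM; apply: Zspan_r. Qed.

(** Both parts of the classification of intermediate ideals are instances, with
    L = F and with L = P^3.  Since f pi L lies in fL, the ideal generated by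
    f u and w = a u + (e u + c v) is Z w modulo fL, so that it represents a
    line; it contains fL because it contains f u, c f v and f^k v. *)
Lemma intermediate_ideals (u v : K) (c e : int) (k : nat) (Q : set K) :
  Zfree u v -> (forall x, Zspan u v x -> Zspan u v (pi * x)) ->
  fK * pi * (fK * u) = fK ^+ k * v -> coprimez c f ->
  is_ideal O Q -> Q `<` Zspan u v -> dilate fK (Zspan u v) `<` Q ->
  (exists2 a : nat, (a < f)%N &
     Q = gen2 O (fK * u) (a%:R * u + (e%:~R * u + c%:~R * v))) \/
  Q = Zspan u (fK * v).
Proof.
move=> fuv piL fpiu cf idQ; rewrite dilate_Zspan.
move=> [QL nLQ] [LQ nQL].
have cQ : Zclosed Q := Zclosed_ideal idQ suborder_int.
have nf1 : ~~ (f %| 1%R)%Z.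
  rewrite dvdzE absz1 dvdn1; apply/eqP=> f1.
  by move: pf; rewrite (f1 : f = 1%N).
have fLP := Zspan_dilateP f fuv.
case: (exists_line_generator pf fuv e cQ QL LQ nQL cf) => [Qu|[a a_lt Qw]].
  right; have cN : Zclosed (Zspan u (fK * v)) by exact: Zclosed_Zspan.
  have LN : Zspan (fK * u) (fK * v) `<=` Zspan u (fK * v).
    by move=> _ [a [b ->]]; exists (a * f), b; ring.
  have NL : Zspan u (fK * v) `<=` Zspan u v.
    by move=> _ [a [b ->]]; exists a, (b * f); ring.
  have nLN : ~ (Zspan u v `<=` Zspan u (fK * v)).
    move=> /(_ _ (Zspan_r _ _))[a [b vE]].
    have [_ ] : 0 = a /\ 1 = b * f.
      by apply: (Zfree_inj fuv); rewrite mul0r add0r mul1r {1}vE; ring.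
    by move=> bf; have := dvdz_mull b (dvdzz f); rewrite -bf; apply/negP.
  have nu : ~ Zspan (fK * u) (fK * v) u.
    move=> h; case/negP: nf1; have [] // : (f %| 1%R)%Z /\ (f %| 0%R)%Z.
    by apply/fLP; rewrite mul0r addr0 mul1r.
  apply/seteqP; split.
    exact: (line_sub pf fuv cQ cN LQ LN QL nLQ Qu (Zspan_l _ _) nu).
  exact: (line_sub pf fuv cN cQ LN LQ NL nLN (Zspan_l _ _) Qu nu).
left; exists a => //.
set w := _ + _ in Qw *; set G := gen2 _ _ _.
have wE : w = (a%:Z + e)%:~R * u + c%:~R * v by rewrite /w; ring.
have nfc : ~~ (f %| c)%Z by rewrite -prime_coprimez.
have cL : Zclosed (Zspan u v) by exact: Zclosed_Zspan.
have mulL x y : D x -> Zspan u v y -> Zspan u v (y * x).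
  move=> [p [q ->]] Ly.
  have -> : y * (p%:~R * 1 + q%:~R * pi) = p%:~R * y + q%:~R * (pi * y) by ring.
  by apply: cL => //; apply: piL.
have thL y : Zspan u v y -> Zspan (fK * u) (fK * v) (fK * pi * y).
  by move=> /piL Ly; rewrite -dilate_Zspan -mulrA; exists (pi * y).
have Lw : Zspan u v w by rewrite wE; exists (a%:Z + e), c.
have cG : Zclosed G by apply: Zclosed_gen2; exact: Zclosed_Zspan.
have Gl x : O x -> G (fK * u * x).
  move=> Ox; apply/gen2P; exists x => //; exists 0; last by rewrite mulr0 addr0.
  exact: (suborder_int 0).
have Gw : G w.
  apply/gen2P; exists 0; first exact: (suborder_int 0).
  by exists 1; [exact: Zspan_l | rewrite mulr0 add0r mulr1].
have Gfu : G (fK * u) by have := Gl 1 (Zspan_l _ _); rewrite mulr1.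
have LG : Zspan (fK * u) (fK * v) `<=` G.
  apply: Zspan_sub => //; apply: (@Zclosed_coprime _ _ c (f%:Z ^+ k)) => //.
  - by rewrite coprimezXr.
  - have -> : c%:~R * (fK * v) = f%:~R * w + (- (a%:Z + e))%:~R * (fK * u).
      by rewrite wE; ring.
    exact: cG.
  - have -> : (f%:Z ^+ k)%:~R * (fK * v) = f%:~R * (fK * u * (fK * pi)).
      by rewrite [fK * u * _]mulrC fpiu rmorphXn mulrCA.
    by apply: Zclosed_scale => //; apply: Gl; exact: Zspan_r.
have GL : G `<=` Zspan u v.
  move=> x /gen2P[p /suborder_sub Dp [q /suborder_sub Dq ->]].
  apply: Zclosed_add => //; apply: mulL => //.
  by exists f, 0; ring.
have nLG : ~ (Zspan u v `<=` G).
  move=> /(_ _ (Zspan_l _ _))/gen2P[_ [p [p' ->]] [_ [q [q' ->]] uE]].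
  have [] : (f %| q * (a%:Z + e) - 1)%Z /\ (f %| q * c)%Z.
    apply/fLP.
    have -> : (q * (a%:Z + e) - 1)%:~R * u + (q * c)%:~R * v =
        (- 1)%:~R * (p%:~R * (fK * u) + (p' * f)%:~R * (fK * pi * u))
         + (- q')%:~R * (fK * pi * w).
      transitivity (q%:~R * w - u); first by rewrite wE; ring.
      by rewrite {1}uE; ring.
    apply: Zclosed_Zspan; last exact: thL.
    apply: Zclosed_Zspan; first exact: Zspan_l.
    by apply: thL; exact: Zspan_l.
  rewrite (prime_dvdzM _ _ pf) (negPf nfc) orbF => fq' fq.
  case/negP: nf1; rewrite -(subKr (q * (a%:Z + e)) 1) rpredB //.
  exact: dvdz_mulr.
have nw : ~ Zspan (fK * u) (fK * v) w.
  by rewrite wE => /fLP[_]; apply/negP.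
apply/seteqP; split.
  exact: (line_sub pf fuv cQ cG LQ LG QL nLQ Qw Gw nw).
exact: (line_sub pf fuv cG cQ LG LQ GL nLG Gw Qw nw).
Qed.

Lemma suborder_ideal I : is_ideal D I -> I `<=` O -> is_ideal O I.
Proof.
move=> [_ I0 addI mulI] IO; split=> // a x Oa.
by apply: mulI; exact: suborder_sub.
Qed.

Lemma dilate_order_ideal : is_ideal D (dilate fK D).
Proof. by apply: dilate_ideal order_ideal order_f. Qed.

Lemma conductor_exp2 :
  ideal_exp O (conductor O D) 2 = dilate fK (dilate fK D).
Proof.
rewrite conductorE /= (@ideal_mulr _ O); last exact: Zspan_l.
  by rewrite ideal_mul_dilate (ideal_mulr dilate_order_ideal order1).
apply: (suborder_ideal dilate_order_ideal) => _ [x Dx <-].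
exact: suborder_dilate.
Qed.

(** k is the norm of y, which is a square of a unit mod f; w is the product of
    z by the conjugate of y.  This expresses that y generates D locally at f. *)
Lemma unit_mod_f y : D y -> ~ P y ->
  exists k, coprimez k f /\ forall z, D z -> exists2 w, D w & k%:~R * z = y * w.
Proof.
move=> Dy; have [a [b yE]] := Dy => nPy.
exists (a * a + a * b * T + b * b * N); split.
  rewrite prime_coprimez //; apply/negP=> fk; apply: nPy.
  suff /dvdzP[q qE] : (f %| a)%Z by exists q, b; rewrite yE qE; ring.
  suff : (f %| a * a)%Z by rewrite prime_dvdzM // => /orP[].
  have -> : a * a = a * a + a * b * T + b * b * N - (a * b * T + b * b * N).
    by ring.
  by rewrite rpredB // rpredD // dvdz_mull.
move=> z Dz; exists (((a + b * T)%:~R * 1 + (- b)%:~R * pi) * z).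
  by apply: order_mul => //; exists (a + b * T), (- b).
transitivity ((a * a + a * b * T)%:~R * z - (b * b)%:~R *
   (T%:~R * pi - N%:~R) * z + (b * b * T)%:~R * pi * z); first by ring.
by rewrite -pi2 yE; ring.
Qed.

(** k is the norm of y divided by f.  It is prime to f, since f divides the
    constant coefficient N exactly once and f does not divide b; w is the
    product of z by the conjugate of y, divided by f.  This expresses that y
    generates P locally at f. *)
Lemma uniformizer_mod_f y : P y -> ~ dilate fK D y ->
  exists k, coprimez k f /\ forall z, P z -> exists2 w, D w & k%:~R * z = y * w.
Proof.
move=> [a [b yE]] nfy; have [t tE] := dvdzP fT; have [n nE] := dvdzP fN.
have nfb : ~~ (f %| b)%Z.
  apply/negP=> /dvdzP[q qE]; apply: nfy; exists (a%:~R * 1 + q%:~R * pi).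
    by exists a, q.
  by rewrite yE qE; ring.
have nfn : ~~ (f %| n)%Z.
  apply/negP=> /dvdzP[q qE]; move/negP: nfN; apply.
  by apply/dvdzP; exists q; rewrite nE qE; ring.
exists (a * a * f + a * b * T + b * b * n); split.
  rewrite prime_coprimez //; apply/negP=> fk.
  have : (f %| b * b * n)%Z.
    have -> : b * b * n = a * a * f + a * b * T + b * b * n
       - (a * a * f + a * b * T) by ring.
    by rewrite rpredB // rpredD // dvdz_mull.
  by rewrite !prime_dvdzM // (negPf nfb) (negPf nfn).
move=> _ [c [d ->]].
exists ((a * c * f + b * c * T + b * d * n)%:~R * 1 + (a * d - b * c)%:~R * pi).
  by do 2!eexists.
rewrite yE; symmetry.
transitivity ((a * f * (a * c * f + b * c * T + b * d * n))%:~R +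
  (a * f * (a * d - b * c) + b * (a * c * f + b * c * T + b * d * n))%:~R * pi +
  (b * (a * d - b * c))%:~R * (pi * pi)); first by ring.
by rewrite pi2 nE; ring.
Qed.

(** Q contains k f^2 z, as the product of f y by the element f w of O, and
    f^n f^2 z, as the product of f^n by an element of O. *)
Lemma absorb_f2 Q n y z k : is_ideal O Q -> Q (fK ^+ n) -> D y -> Q (fK * y) ->
  coprimez k f -> D z -> (exists2 w, D w & k%:~R * z = y * w) ->
  Q (fK * (fK * z)).
Proof.
move=> idQ Qn Dy Qy kf Dz [w Dw kz]; have [_ _ _ mulQ] := idQ.
have cQ : Zclosed Q := Zclosed_ideal idQ suborder_int.
apply: (@Zclosed_coprime _ _ k (f%:Z ^+ n)) => //; first by rewrite coprimezXr.
  have -> : k%:~R * (fK * (fK * z)) = fK * w * (fK * y).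
    by transitivity (fK * fK * (k%:~R * z)); [ring | rewrite kz; ring].
  by apply: mulQ => //; exact: suborder_dilate.
rewrite rmorphXn mulrC; apply: mulQ => //.
by apply: suborder_dilate; apply: order_mul => //; exact: order_f.
Qed.

(** If Q is not contained in P^3, it has an element f y with y a unit at P, and
    f y absorbs f^2 D = P^4.  If Q is contained in P^3, it has, being basic, an
    element f y with y a uniformizer at P, and f y absorbs f^2 P = P^5. *)
Lemma basic_primary_between Q :
  is_ideal D P -> dilate fK D = ideal_exp D P 2 ->
  Q `<=` conductor O D -> basic_primary O (conductor O D) Q ->
  (ideal_exp D P 4 `<` Q /\ Q `<=` ideal_exp D P 2) \/
  (ideal_exp D P 5 `<` Q /\ Q `<=` ideal_exp D P 3).
Proof.
move=> idP P2; rewrite /basic_primary conductor_exp2 conductorE.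
rewrite (ideal_exp5 order1 idP P2) (ideal_exp4 order1 idP P2).
rewrite (ideal_exp3 order1 idP P2) -P2.
move=> QF [[[idQ _ _] radQ] nQ].
have [n _ Qn] : exists2 n, (0 < n)%N & Q (fK ^+ n).
  have : dilate fK D fK by exists 1; [exact: order1 | rewrite mulr1].
  by rewrite -radQ => -[].
have PD : P `<=` D by case: idP.
have [QP|nQP] := pselect (Q `<=` dilate fK P).
  right; split=> //; have /existsNP[x /not_implyP[Qx nx]] := nQ.
  have [y Py yE] := QP _ Qx; rewrite -yE in Qx nx.
  have [|k [kf kP]] := uniformizer_mod_f Py.
    by move=> Fy; apply: nx; exists y.
  split; last by move=> /(_ _ Qx)[z [t Pt <-] e]; apply: nx; exists y => //;
    by exists t; [exact: PD | exact: (mulfI fK_neq0 e)].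
  move=> _ [_ [z Pz <-] <-].
  by apply: (absorb_f2 idQ Qn (PD _ Py) Qx kf (PD _ Pz)); exact: kP.
left; split=> //; have /existsNP[x /not_implyP[Qx nx]] := nQP.
have [y Dy yE] := QF _ Qx; rewrite -yE in Qx nx.
have [|k [kf kD]] := unit_mod_f Dy.
  by move=> Py; apply: nx; exists y.
split=> // _ [_ [z Dz <-] <-].
by apply: (absorb_f2 idQ Qn Dy Qx kf Dz); exact: kD.
Qed.

Lemma suborder_gen2 (a b : K) : Zclosed (gen2 O a b) /\
  (forall x, O x -> gen2 O a b (a * x)) /\ gen2 O a b b.
Proof.
split; first by apply: Zclosed_gen2; exact: Zclosed_Zspan.
split=> [x Ox|]; apply/gen2P.
  by exists x => //; exists 0; [exact: (suborder_int 0) | rewrite mulr0 addr0].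
exists 0; first exact: (suborder_int 0).
by exists 1; [exact: Zspan_l | rewrite mulr0 add0r mulr1].
Qed.

Lemma gen2_fO (c e : int) :
  gen2 O fK (fK ^+ 2 * (c%:~R * pi + e%:~R)) = dilate fK O.
Proof.
have [_ [Gl _]] := suborder_gen2 fK (fK ^+ 2 * (c%:~R * pi + e%:~R)).
apply/seteqP; split=> [x /gen2P[_ [p [q ->]] [_ [p' [q' ->]] ->]]|]; last first.
  by move=> _ [x Ox <-]; apply: Gl.
exists ((p + p' * e * f - q' * f ^+ 2 * c * N)%:~R * 1
        + (q + p' * c + q' * f * e + q' * f * c * T)%:~R * (fK * pi)).
  by do 2!eexists.
transitivity (fK * (p%:~R * 1 + q%:~R * (fK * pi)) + fK ^+ 2 *
   ((p' * e)%:~R + (p' * c)%:~R * pi + (q' * e)%:~R * fK * pi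
     + (q' * c)%:~R * fK * (pi * pi))); last by ring.
by rewrite pi2; ring.
Qed.

Lemma gen2_f2D (c e : int) : coprimez c f ->
  gen2 O (fK ^+ 2) (fK ^+ 2 * (c%:~R * pi + e%:~R)) = dilate fK (dilate fK D).
Proof.
move=> cf; set h := _ + _.
have [cG [Gl Gh]] := suborder_gen2 (fK ^+ 2) (fK ^+ 2 * h).
have G1 := Gl 1 (Zspan_l _ _).
apply/seteqP; split.
  move=> x /gen2P[p /suborder_sub Dp [q /suborder_sub Dq ->]].
  exists (fK * (p + h * q)); last by ring.
  exists (p + h * q) => //.
  apply: Zclosed_add => //; first exact: Zclosed_Zspan.
  by apply: order_mul => //; exists e, c; rewrite /h; ring.
rewrite !dilate_Zspan; apply: Zspan_sub => //.
  by rewrite mulrA -expr2.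
apply: (@Zclosed_coprime _ _ c f) => //.
  have -> : c%:~R * (fK * (fK * pi)) =
      1%:~R * (fK ^+ 2 * h) + (- e)%:~R * (fK ^+ 2 * 1) by rewrite /h; ring.
  exact: cG.
have -> : f%:~R * (fK * (fK * pi)) = fK ^+ 2 * (fK * pi) by ring.
by apply: Gl; exact: Zspan_r.
Qed.

(** The lattice F is spanned by f and f pi; c and e are arbitrary, so that
    c pi + e can be a square root of d, which does not generate D when
    d = 1 mod 4. *)
Lemma ideals_F_F2 (c e : int) Q : coprimez c f -> is_ideal O Q ->
  Q `<` conductor O D -> ideal_exp O (conductor O D) 2 `<` Q ->
  (exists2 a : nat, (a < f)%N &
     Q = gen2 O (fK ^+ 2) (fK * (a%:R + (c%:~R * pi + e%:~R)))) \/
  Q = dilate fK O.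
Proof.
move=> cf idQ; rewrite conductor_exp2 conductorE dilate_Zspan mulr1 => QF FQ.
have free_F : Zfree fK (fK * pi).
  by rewrite -[X in Zfree X]mulr1; exact: (Zfree_dilate fK_neq0 fr).
have piF x : Zspan fK (fK * pi) x -> Zspan fK (fK * pi) (pi * x).
  have -> : Zspan fK (fK * pi) = dilate fK D by rewrite dilate_Zspan mulr1.
  exact: (order_ideal_pi dilate_order_ideal).
have fpiF : fK * pi * (fK * fK) = fK ^+ 2 * (fK * pi) by ring.
case: (intermediate_ideals e free_F piF fpiF cf idQ QF FQ) => [[a a_lt ->]|->].
  left; exists a => //; rewrite -expr2; congr (gen2 _ _ _); ring.
by right; rewrite dilate_Zspan mulr1.
Qed.

(** P^3 = fP is spanned by f^2 and f pi.  In contrast with the case of F, the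
    element c pi + e f used as origin has to lie in P. *)
Lemma ideals_P3_P5 (c e : int) Q :
  is_ideal D P -> dilate fK D = ideal_exp D P 2 -> coprimez c f ->
  is_ideal O Q -> Q `<` ideal_exp D P 3 -> ideal_exp D P 5 `<` Q ->
  (exists2 a : nat, (a < f)%N & Q = gen2 O (fK ^+ 3)
      (a%:R * fK ^+ 2 + fK * (c%:~R * pi + e%:~R * fK))) \/
  Q = ideal_exp D P 4.
Proof.
move=> idP P2 cf idQ.
rewrite (ideal_exp5 order1 idP P2) (ideal_exp4 order1 idP P2).
rewrite (ideal_exp3 order1 idP P2) => QP PQ.
have free_fP := Zfree_dilate fK_neq0 Zfree_P.
have id_fP := dilate_ideal idP order_f.
move: QP PQ (order_ideal_pi id_fP); rewrite dilate_Zspan => QP PQ piP.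
have fpiP : fK * pi * (fK * (fK * fK)) = fK ^+ 3 * (fK * pi) by ring.
case: (intermediate_ideals e free_fP piP fpiP cf idQ QP PQ) => [[a a_lt ->]|->].
  left; exists a => //; rewrite -expr2 -exprS; congr (gen2 _ _ _); ring.
by right; rewrite !dilate_Zspan mulr1.
Qed.

End EisensteinOrder.

(** * The ring of integers of a quadratic field *)

(** Gauss's lemma: the factor is a rational multiple of an integral factor,
    whose leading coefficient is a unit. *)
Lemma monic_rat_factor_int (m : {poly rat}) (p : {poly int}) :
  m \is monic -> p \is monic -> (m %| map_poly (intr : int -> rat) p) ->
  exists m' : {poly int}, m = map_poly (intr : int -> rat) m'.
Proof.
move=> mon_m mon_p /dvdpP_rat_int[p1 [a a0 mE] [r pE]].
have lc : lead_coef p1 * lead_coef r = 1.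
  by rewrite -lead_coefM -pE; apply/monicP.
have lm : a * (lead_coef p1)%:~R = 1.
  move/monicP: mon_m; rewrite mE lead_coefZ lead_coef_map_inj //.
  exact: (@intr_inj rat).
exists (lead_coef r *: p1); rewrite mE map_polyZ; congr (_ *: _).
have lc' : (lead_coef p1)%:~R * (lead_coef r)%:~R = 1 :> rat.
  by rewrite -intrM lc.
by rewrite -[LHS]mulr1 -lc' mulrA lm mul1r.
Qed.

Lemma int_unit_sqr (n : int) : n \is a GRing.unit -> n ^+ 2 = 1.
Proof. by move=> /orP[/eqP->|/eqP->]; rewrite ?sqrrN expr1n. Qed.

(** The square of the denominator of q divides d. *)
Lemma squarefree_denominator (d : int) (q : rat) (m : int) : squarefree d ->
  q ^+ 2 * d%:~R = m%:~R -> exists n : int, q = n%:~R.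
Proof.
move=> sf e.
have e' : numq q ^+ 2 * d = m * denq q ^+ 2.
  apply: (@intr_inj rat); rewrite !intrM -e numqE; ring.
have : (denq q ^+ 2 %| d)%Z.
  rewrite -(@Gauss_dvdzr _ (numq q ^+ 2)); first by rewrite e' dvdz_mull.
  by rewrite coprimezXl // coprimezXr // coprimez_sym coprimezE coprime_num_den.
move/sf/int_unit_sqr => den1; exists (numq q); rewrite -[LHS]divq_num_den.
have den_gt0 := denq_gt0 q.
have {den1}-> : denq q = 1 by nia.
by rewrite divr1.
Qed.

(** Squares are 0 or 1 mod 4, so t and r have the same parity when d = 1 mod 4,
    and are both even when d = 2 or 3 mod 4. *)
Lemma quadratic_parity (d t r n : int) : t * t - d * (r * r) = 4 * n ->
  ~~ (4 %| d)%Z ->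
  if (d == 1 %[mod 4])%Z then exists u, t = 2 * u + r
  else exists u v, t = 2 * u /\ r = 2 * v.
Proof.
move=> e d4.
have split2 (x : int) : exists u, x = 2 * u \/ x = 2 * u + 1.
  by exists (x %/ 2)%Z; lia.
have [u tE] := split2 t; have [v rE] := split2 r.
have tt : exists y, t * t = 4 * y + (t - 2 * u).
  by case: tE => ->; [exists (u * u) | exists (u * u + u)]; ring.
have rr : exists z, d * (r * r) = 4 * z + d * (r - 2 * v).
  by case: rE => ->; [exists (d * v * v) | exists (d * v * v + d * v)]; ring.
have [y yE] := tt; have [z zE] := rr; rewrite yE zE in e.
case: ifP => d14; last first.
  exists u, v; case: tE rE e => -> [] ->; lia.
exists (u - v); case: tE rE e => -> [] ->; lia.
Qed.

Section QuadraticField.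
(* The rationals enter through a morphism, which spares scalar multiplication
   in all computations. *)
Variables (K : fieldType) (phi : {rmorphism rat -> K}) (d : int) (s : K).
Hypotheses (sf : squarefree d) (d1 : d != 1) (s2 : s ^+ 2 = d%:~R).

Lemma phi_int (n : int) : phi n%:~R = n%:~R.
Proof. exact: rmorph_int. Qed.

Lemma sqrt_irrational (q : rat) : phi q != s.
Proof.
apply/eqP=> qs.
have q2 : q ^+ 2 = d%:~R.
  by apply: (fmorph_inj phi); rewrite rmorphXn /= qs s2 phi_int.
have [n nE] : exists n : int, q = n%:~R.
  by apply: (@squarefree_denominator d _ (d * d) sf); rewrite q2 -intrM.
have dE : d = n ^+ 2.
  by apply: (@intr_inj rat); rewrite -q2 nE rmorphXn.
move/eqP: d1; apply; rewrite dE; apply: int_unit_sqr; apply: sf.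
by rewrite dE dvdzz.
Qed.

Lemma rat_free (a b : rat) : phi a + phi b * s = 0 -> a = 0 /\ b = 0.
Proof.
have [-> | b0 e] := eqVneq b 0.
  by rewrite rmorph0 mul0r addr0 => /eqP; rewrite fmorph_eq0 => /eqP.
have /eqP[] := sqrt_irrational (- a / b).
rewrite rmorphM fmorphV rmorphN; apply: (mulIf (_ : phi b != 0)).
  by rewrite fmorph_eq0.
rewrite mulfVK ?fmorph_eq0 //; apply/eqP.
by rewrite eq_sym -subr_eq0 opprK addrC mulrC e.
Qed.

(** The trace and the norm are coefficients of the minimal polynomial m, which
    divides the integral equation of the element; for b = 0 the minimal
    polynomial is linear instead. *)
Lemma integral_trace_norm (a b : rat) :
  integralOver (intr : int -> K) (phi a + phi b * s) ->
  exists t n : int, 2 * a = t%:~R /\ a ^+ 2 - d%:~R * b ^+ 2 = n%:~R.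
Proof.
move=> [p mon_p]; set x := _ + _ => /rootP px.
have pE : map_poly phi (map_poly intr p) = map_poly intr p.
  by rewrite -map_poly_comp; apply: eq_map_poly => n; rewrite /= phi_int.
have mon_pQ : map_poly (intr : int -> rat) p \is monic by rewrite monic_map.
have [b0|b0] := eqVneq b 0.
  have xE : x = phi a by rewrite /x b0 rmorph0 mul0r addr0.
  have aroot : root (map_poly (intr : int -> rat) p) a.
    by rewrite -(fmorph_root phi) pE -xE; apply/rootP.
  have [m mE] := monic_rat_factor_int (monicXsubC a) mon_p
    (etrans (dvdp_XsubCl _ _) aroot).
  have aE : a = (- m`_0)%:~R.
    have := congr1 (fun q : {poly rat} => - q`_0) mE.
    by rewrite coef_map coefB coefX coefC /= sub0r opprK => ->; rewrite rmorphN.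
  exists (2 * - m`_0), ((- m`_0) ^+ 2); rewrite aE b0; split; ring.
pose m : {poly rat} :=
  'X^2 + ((- (2 * a)) *: 'X + (a ^+ 2 - d%:~R * b ^+ 2)%:P).
have szm' : (size ((- (2 * a)) *: 'X + (a ^+ 2 - d%:~R * b ^+ 2)%:P)%R < 3)%N.
  rewrite ltnS (leq_trans (size_polyD _ _)) // geq_max.
  rewrite (leq_trans (size_scale_leq _ _)) ?size_polyX //.
  exact: leq_trans (size_polyC_leq1 _) _.
have mon_m : m \is monic.
  by rewrite monicE lead_coefDl ?lead_coefXn // size_polyXn.
have szm : size m = 3%N by rewrite size_polyDl size_polyXn.
have mx : (map_poly phi m).[x] = 0.
  rewrite /m rmorphD /= map_polyXn rmorphD /= map_polyZ map_polyX map_polyC.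
  rewrite !hornerE /=.
  transitivity (phi b ^+ 2 * (s ^+ 2 - d%:~R)); last by rewrite s2 subrr mulr0.
  by rewrite /x; ring.
have dv : (m %| map_poly intr p)%R.
  rewrite /dvdp; set r := modp _ _.
  have szr : (size r <= 2)%N by rewrite -ltnS -szm ltn_modp -size_poly_eq0 szm.
  have rx : (map_poly phi r).[x] = 0.
    have := divp_eq (map_poly intr p) m.
    move=> /(congr1 (fun q => (map_poly phi q).[x])).
    by rewrite /= rmorphD rmorphM /= hornerD hornerM mx mulr0 add0r pE px => ->.
  have rE : r = (r`_0)%:P + r`_1 *: 'X.
    apply/polyP => i; rewrite coefD coefC coefZ coefX.
    case: i => [|[|i]] /=; rewrite ?mulr0 ?addr0 ?mulr1 ?add0r //.
    by rewrite nth_default // (leq_trans szr).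
  have [h1 h2] : r`_0 + r`_1 * a = 0 /\ r`_1 * b = 0.
    apply: rat_free; transitivity (phi r`_0 + phi r`_1 * x).
      by rewrite /x; ring.
    rewrite -[RHS]rx [X in map_poly _ X]rE rmorphD /= map_polyZ map_polyX.
    by rewrite map_polyC !hornerE.
  move/eqP: h2; rewrite mulf_eq0 (negPf b0) orbF => /eqP r1.
  by move: h1; rewrite r1 mul0r addr0 => r0; rewrite rE r0 r1 scale0r addr0.
have [m' mE] := monic_rat_factor_int mon_m mon_p dv.
exists (- m'`_1), (m'`_0); split.
  have := congr1 (fun q : {poly rat} => - q`_1) mE.
  rewrite coef_map /m !coefD coefXn coefZ coefX coefC /= => e.
  by rewrite rmorphN /= -e; ring.
have := congr1 (fun q : {poly rat} => q`_0) mE.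
by rewrite coef_map /m !coefD coefXn coefZ coefX coefC /= => <-; ring.
Qed.

Lemma squarefree_mod4 : ~~ (4 %| d)%Z.
Proof.
by apply/negP=> d4; have /int_unit_sqr := sf (d4 : (2 ^+ 2 %| d)%Z).
Qed.

Lemma sqrt_free : Zfree 1 s.
Proof.
move=> a b e; have [] : a%:~R = 0 :> rat /\ b%:~R = 0 :> rat.
  by apply: rat_free; rewrite !phi_int -e; ring.
by split; apply: (@intr_inj rat).
Qed.

Lemma two_neq0 : (2 : K) != 0.
Proof.
by rewrite -(rmorph_nat phi 2) fmorph_eq0.
Qed.

Lemma omega_double : (d == 1 %[mod 4])%Z -> 2 * omega d s = 1 + s.
Proof. by move=> d14; rewrite /omega d14 mulrC divfK // two_neq0. Qed.

Lemma omega_id : (d != 1 %[mod 4])%Z -> omega d s = s.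
Proof. by move=> /negPf d14; rewrite /omega d14. Qed.

Lemma omega_sqr1 (k : int) : (d == 1 %[mod 4])%Z -> d = 4 * k + 1 ->
  omega d s * omega d s = omega d s + k%:~R.
Proof.
move=> d14 dE; apply: (mulfI two_neq0); apply: (mulfI two_neq0).
transitivity ((2 * omega d s) * (2 * omega d s)); first by ring.
transitivity (2 * (2 * omega d s) + 4 * k%:~R); last by ring.
rewrite omega_double //; transitivity (1 + 2 * s + s ^+ 2); first by ring.
by rewrite s2 dE; ring.
Qed.

Lemma integral_omega : integralOver (intr : int -> K) (omega d s).
Proof.
have [d14|nd14] := boolP (d == 1 %[mod 4])%Z.
  have [k dE] : exists k, d = 4 * k + 1 by exists (d %/ 4)%Z; lia.
  exists ('X^2 - ('X + k%:P)).
    rewrite monicE lead_coefDl ?lead_coefXn //.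
    by rewrite size_polyN size_XaddC size_polyXn.
  rewrite /root rmorphB rmorphD /= map_polyXn map_polyX map_polyC !hornerE.
  by rewrite expr2 (omega_sqr1 d14 dE) subrr.
rewrite omega_id //; exists ('X^2 - d%:P).
  rewrite monicE lead_coefDl ?lead_coefXn // size_polyN size_polyXn.
  exact: leq_trans (size_polyC_leq1 _) _.
by rewrite /root rmorphB /= map_polyXn map_polyC !hornerE s2 subrr.
Qed.

Lemma Zfree_affine (pi : K) (c e : int) :
  c != 0 -> s = c%:~R * pi + e%:~R -> Zfree 1 pi.
Proof.
move=> c0 sE a b ab0; have [h b0] : c * a - b * e = 0 /\ b = 0.
  apply: sqrt_free; rewrite sE.
  transitivity (c%:~R * (a%:~R * 1 + b%:~R * pi)); first by ring.
  by rewrite ab0 mulr0.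
split=> //; move/eqP: h; rewrite b0 mul0r subr0 mulf_eq0 (negPf c0).
by move/eqP.
Qed.

(** If d = 1 mod 4, then f is odd and pi = (f + s) / 2, so that T = f and
    4 N = f^2 - d.  If d is not 1 mod 4 and f divides d, then pi = s.  The
    remaining case is f = 2 and d = 3 mod 4, where pi = 1 + s and N = 1 - d is
    2 mod 4.  The last clause tells which of s and 1 + s lies in the prime
    above f. *)
Lemma exists_eisenstein_generator (f : nat) : prime f ->
  (f %| d)%Z \/ f = 2%N /\ (d != 1 %[mod 4])%Z ->
  exists pi (j T N c e : int),
  [/\ pi = omega d s + j%:~R, pi * pi = T%:~R * pi - N%:~R,
      [/\ (f %| T)%Z, (f %| N)%Z & ~~ (f * f %| N)%Z],
      s = c%:~R * pi + e%:~R /\ coprimez c f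
    & if (f == 2%N) && (d == 3 %[mod 4])%Z then 1 + s = pi else (f %| e)%Z].
Proof.
move=> pf ram.
have f2d : ~~ (f * f %| d)%Z.
  apply/negP=> fd; have := int_unit_sqr (sf (_ : (f%:Z ^+ 2 %| d)%Z)).
  by move=> /(_ fd); have := prime_gt1 pf; nia.
have d4 := squarefree_mod4.
have cop1 : coprimez 1 f by rewrite coprimezE coprime1n.
have [exc|] := boolP ((f == 2%N) && (d == 3 %[mod 4])%Z).
  case/andP: exc => /eqP f2 d3.
  exists (1 + s), 1, 2, (1 - d), 1, (-1); split=> //.
  - by rewrite omega_id; [ring | lia].
  - by transitivity (1 + 2 * s + s ^+ 2); [ring | rewrite s2; ring].
  - by rewrite f2; split=> //; lia.
  - by split=> //; ring.
move=> nexc; have fd : (f %| d)%Z.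
  by case: ram => // -[f2 d1']; move: nexc; rewrite f2 /=; lia.
have [d14|nd14] := boolP (d == 1 %[mod 4])%Z; last first.
  exists s, 0, 0, (- d), 1, 0; split=> //.
  - by rewrite omega_id // addr0.
  - by rewrite -expr2 s2; ring.
  - by split; rewrite ?rpredN.
  - by split=> //; ring.
have [g fE] : exists g : int, f = 2 * g + 1 :> int.
  exists (f %/ 2)%N; have [q qE] := dvdzP fd; rewrite qE in d14.
  suff : odd f by lia.
  apply/negPn/negP=> f_even.
  have [h hE] : exists h : int, f = 2 * h :> int by exists (f %/ 2)%N; lia.
  by rewrite hE in d14; lia.
have [k dE] : exists k, d = 4 * k + 1 by exists (d %/ 4)%Z; lia.
have NE : 4 * (g * g + g - k) = f%:Z * f%:Z - d by rewrite fE dE; ring.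
have cop2 : coprimez 2 f.
  rewrite prime_coprimez //; apply/negP; rewrite dvdzE => /dvdn_leq.
  by have := prime_gt1 pf; lia.
have cop4 : coprimez f 4.
  by rewrite coprimez_sym; exact: (@coprimezXl 2 2 f cop2).
have cop4' : coprimez (f * f) 4.
  exact: (@coprimezXl 2 f 4 cop4).
exists (omega d s + g%:~R), g, f, (g * g + g - k), 2, (- f%:Z); split=> //.
- transitivity (omega d s * omega d s + 2 * g%:~R * omega d s + g%:~R ^+ 2).
    by ring.
  by rewrite (omega_sqr1 d14 dE) fE; ring.
- split=> //; first by rewrite -(Gauss_dvdzr _ cop4) NE rpredB // dvdz_mull.
  rewrite -(Gauss_dvdzr _ cop4') NE; apply/negP=> h; case/negP: f2d.
  have -> : d = f%:Z * f%:Z - (f%:Z * f%:Z - d) by ring.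
  by rewrite rpredB.
- split=> //; transitivity (2 * omega d s - 1); last by rewrite fE; ring.
  by rewrite omega_double //; ring.
- by rewrite rpredN.
Qed.

Hypothesis phi_s_gen : forall x : K, exists a b, x = phi a + phi b * s.

(** An integral element is (t + r s) / 2 with t its trace and r an integer,
    since r^2 d = t^2 - 4n with n its norm; the parities of t and r then
    decide. *)
Lemma ring_of_integersE : ring_of_integers K = Zspan 1 (omega d s).
Proof.
apply/seteqP; split=> [x|_ [a [b ->]]]; last first.
  have int_intr (n : int) : integralOver (intr : int -> K) n%:~R.
    exact: (integral_id (intr : {rmorphism int -> K})).
  have intD := @integral_add int K intr; have intM := @integral_mul int K intr.
  rewrite mulr1; apply: intD => //; apply: intM => //; exact: integral_omega.
have [a [b ->]] := phi_s_gen x.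
move/integral_trace_norm => [t [n [at_ ab]]].
have [r br] : exists r : int, 2 * b = r%:~R.
  apply: (@squarefree_denominator d _ (t * t - 4 * n) sf).
  by rewrite intrB !intrM -at_ -ab; ring.
have e : t * t - d * (r * r) = 4 * n.
  by apply: (@intr_inj rat); rewrite intrB !intrM -at_ -ab -br; ring.
have x2 : 2 * (phi a + phi b * s) = t%:~R + r%:~R * s.
  by rewrite -!phi_int -at_ -br; ring.
have := quadratic_parity e squarefree_mod4.
case: ifP => d14 [u].
  move=> tE; exists u, r; apply: (mulfI two_neq0); rewrite x2 tE.
  transitivity ((2 * u)%:~R + r%:~R * (1 + s)); first by ring.
  by rewrite -omega_double //; ring.
move=> [v [tE rE]]; exists u, v; rewrite omega_id ?d14 //.
by apply: (mulfI two_neq0); rewrite x2 tE rE; ring.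
Qed.

End QuadraticField.

Lemma ZadjoinE (K : fieldType) (x : K) (t n : int) :
  x * x = t%:~R * x + n%:~R -> Zadjoin x = Zspan 1 x.
Proof.
move=> xx; apply/seteqP; split=> [_ [p ->]|_ [a [b ->]]]; last first.
  exists (a%:P + b *: 'X).
  by rewrite rmorphD /= map_polyC map_polyZ map_polyX !hornerE.
elim/poly_ind: p => [|p c [a [b IHp]]].
  by rewrite rmorph0 horner0; exists 0, 0; ring.
rewrite rmorphD rmorphM /= map_polyX map_polyC !hornerE IHp.
exists (b * n + c), (a + b * t).
transitivity (a%:~R * x + b%:~R * (x * x) + c%:~R); first by ring.
by rewrite xx; ring.
Qed.

(** * Ramification and the discriminant *)

Lemma quadratic_span (K : fieldExtType rat) (s : K) (d : int) :
  s ^+ 2 = d%:~R -> <<1; s>>%VS = fullv ->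
  forall x : K, exists a b : rat, x = in_alg K a + in_alg K b * s.
Proof.
move=> s2 gen x; have : x \in <<1; s>>%VS by rewrite gen memvf.
move=> /Fadjoin_polyP[p /polyOverP p_rat ->]; rewrite horner_coef.
apply: (big_ind (fun y => exists a b : rat, y = in_alg K a + in_alg K b * s))
  => [|_ _ [a [b ->]] [a' [b' ->]]|i _].
- by exists 0, 0; ring.
- by exists (a + a'), (b + b'); ring.
have /vlineP[c ->] := p_rat i.
have [a [b ->]] : exists a b : rat, s ^+ i = in_alg K a + in_alg K b * s.
  elim: (i : nat) => [|n [a [b IHn]]]; first by exists 1, 0; ring.
  exists (b * d%:~R), a; rewrite exprSr IHn.
  transitivity (in_alg K a * s + in_alg K b * s ^+ 2); first by ring.
  by rewrite s2; ring.
exists (c * a), (c * b); rewrite -[c *: 1]/(in_alg K c); ring.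
Qed.

(** If P were contained in cA, then cA, the square of P, would be contained in
    cP, whence P = A. *)
Lemma exists_sqr_in_dilate (K : fieldType) (A P : set K) (c : K) :
  A 1 -> c != 0 -> is_ideal A P -> P <> A -> dilate c A = ideal_exp A P 2 ->
  exists x, [/\ P x, ~ dilate c A x & dilate c A (x * x)].
Proof.
move=> A1 c0 idP nP P2; have [PA P0 addP mulP] := idP.
have [PcA|] := pselect (P `<=` dilate c A); last first.
  move=> /existsNP[x /not_implyP[Px nx]]; exists x; split=> //.
  by rewrite -(ideal_mul_self A1 idP P2); apply: ideal_mul_prod.
have cc : ideal_mul P P c.
  by rewrite (ideal_mul_self A1 idP P2); exists 1 => //; rewrite mulr1.
have [y Py yE] : dilate c P c.
  apply: (ideal_mul_sub _ _ _ cc).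
  - by exists 0; rewrite ?mulr0.
  - move=> _ _ [y Py <-] [z Pz <-]; exists (y + z); last by rewrite mulrDr.
    exact: addP.
  - move=> x _ Px /PcA[z Az <-]; exists (z * x); last by ring.
    exact: mulP.
have y1 : y = 1 by apply: (mulfI c0); rewrite yE mulr1.
case: nP; apply/seteqP; split=> // a Aa.
by rewrite -[a]mulr1; apply: mulP => //; rewrite -y1.
Qed.

(** An element x = a + b w outside fD with square in fD is a nonzero nilpotent
    of D / fD.  Reducing x^2 mod f shows that f divides the discriminant, which
    is d when e holds and 4d otherwise. *)
Lemma ramified_divides (K : fieldType) (w x : K) (d k : int) (e : bool)
    (f : nat) :
  prime f -> Zfree 1 w -> w * w = e%:R * w + k%:~R ->
  d = (if e then 4 * k + 1 else k) ->
  Zspan 1 w x -> ~ dilate f%:R (Zspan 1 w) x ->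
  dilate f%:R (Zspan 1 w) (x * x) ->
  (f %| d)%Z \/ f = 2%N /\ ~~ e.
Proof.
move=> pf fr ww dE [a [b xE]] nx; rewrite dilate_Zspan.
have -> : x * x = (a * a + b * b * k)%:~R * 1 + (2 * a * b + b * b * e)%:~R * w.
  transitivity (a%:~R * a%:~R + (2 * a * b)%:~R * w + (b * b)%:~R * (w * w)).
    by rewrite xE; ring.
  by rewrite ww; ring.
case/(Zspan_dilateP f fr) => h1 h2.
have nfb : ~~ (f %| b)%Z.
  apply/negP=> fb; have : (f %| a * a)%Z.
    have -> : a * a = a * a + b * b * k - b * b * k by ring.
    by rewrite rpredB // -mulrA dvdz_mulr.
  rewrite prime_dvdzM // => /orP fa; apply: nx.
  have /dvdzP[p pE] : (f %| a)%Z by case: fa.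
  have [q qE] := dvdzP fb.
  exists (p%:~R * 1 + q%:~R * w); first by exists p, q.
  by rewrite xE pE qE; ring.
have fab : (f %| 2 * a + b * e)%Z.
  have : (f %| b * (2 * a + b * e))%Z.
    by have -> : b * (2 * a + b * e) = 2 * a * b + b * b * e by ring.
  by rewrite prime_dvdzM // (negPf nfb).
have fbd : (f %| b * b * d)%Z -> (f %| d)%Z.
  by rewrite !prime_dvdzM // (negPf nfb).
case: e dE ww h2 fab => /= dE ww h2 fab.
  left; apply: fbd.
  have -> : b * b * d = 4 * (a * a + b * b * k) - (2 * a + b * 1) * (2 * a - b).
    by rewrite dE; ring.
  by apply: rpredB; [exact: dvdz_mull | exact: dvdz_mulr].
move: fab; rewrite mulr0 addr0 prime_dvdzM // => /orP[f2|fa].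
  by right; split=> //; apply/eqP; rewrite -(dvdn_prime2 pf).
left; apply: fbd; rewrite dE.
have -> : b * b * k = a * a + b * b * k - a * a by ring.
by rewrite rpredB // dvdz_mulr.
Qed.

(** * Ideals of the order of index f when f ramifies *)

Theorem theorem4p9 (d : int) (K : fieldExtType rat) (s : K) (f : nat)
    (P : set K) :
  squarefree d -> d != 1 ->
  s ^+ 2 = d%:~R -> <<1; s>>%VS = fullv ->
  prime f ->
  let D := ring_of_integers K in
  let O := Zadjoin (f%:R * omega d s) in
  let F := conductor O D in
  let fK : K := f%:R in
  prime_ideal D P -> dilate fK D = ideal_exp D P 2 ->
  [/\ (* (i) *)
      ((d = 1 %[mod 4])%Z \/ (d = 2 %[mod 4])%Z \/
         ((d = 3 %[mod 4])%Z /\ f <> 2%N) ->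
         P = gen2 D fK s) /\
      ((d = 3 %[mod 4])%Z /\ f = 2%N ->
         P = gen2 D 2 (1 + s)),
      (* (ii) *)
      (forall Q : set K, Q `<=` F -> basic_primary O F Q ->
         (ideal_exp D P 4 `<` Q /\ Q `<=` ideal_exp D P 2) \/
         (ideal_exp D P 5 `<` Q /\ Q `<=` ideal_exp D P 3)),
      (* (iii) *)
      gen2 O fK (fK ^+ 2 * s) = dilate fK O /\
      (forall Q : set K, is_ideal O Q -> Q `<` F -> ideal_exp O F 2 `<` Q ->
         (exists2 a : nat, (a < f)%N &
            Q = gen2 O (fK ^+ 2) (fK * (a%:R + s))) \/
         Q = gen2 O fK (fK ^+ 2 * s))
    & (* (iv) *)
      [/\ ideal_exp D P 5 = dilate fK (ideal_exp D P 3),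
          (~ (f = 2%N /\ (d = 3 %[mod 4])%Z) ->
             [/\ gen2 O (fK ^+ 2) (fK ^+ 2 * s) = dilate fK F,
                 dilate fK F = ideal_exp D P 4
               & forall Q : set K, is_ideal O Q ->
                   Q `<` ideal_exp D P 3 -> ideal_exp D P 5 `<` Q ->
                   (exists2 a : nat, (a < f)%N &
                      Q = gen2 O (fK ^+ 3) (a%:R * fK ^+ 2 + fK * s)) \/
                   Q = gen2 O (fK ^+ 2) (fK ^+ 2 * s)])
        & (f = 2%N /\ (d = 3 %[mod 4])%Z ->
             gen2 O 4 (4 * (1 + s)) = ideal_exp D P 4 /\
             forall Q : set K, is_ideal O Q ->
               Q `<` ideal_exp D P 3 -> ideal_exp D P 5 `<` Q ->
               [\/ Q = gen2 O 8 (2 * (1 + s)),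
                   Q = gen2 O 8 (4 + 2 * (1 + s))
                 | Q = gen2 O 4 (4 * (1 + s))])]].
Proof.
move=> sf d1 s2 gen pf D O F fK prP P2; subst fK.
have [idP nP _] := prP.
pose phi : {rmorphism rat -> K} := in_alg K.
have span := quadratic_span s2 gen.
have DE : D = Zspan 1 (omega d s).
  exact: (@ring_of_integersE K phi d s sf d1 s2 span).
have f0 : (f%:R : K) != 0.
  rewrite -(rmorph_nat phi f) fmorph_eq0 Num.Theory.pnatr_eq0 -lt0n.
  exact: prime_gt0.
have D1 : D 1 by rewrite DE; exact: Zspan_l.
have [k [wk dk]] : exists k : int,
    omega d s * omega d s = (d == 1 %[mod 4])%Z%:R * omega d s + k%:~R
    /\ d = if (d == 1 %[mod 4])%Z then 4 * k + 1 else k.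
  have [d14|nd14] := boolP (d == 1 %[mod 4])%Z.
    have [k dE] : exists k, d = 4 * k + 1 by exists (d %/ 4)%Z; lia.
    by exists k; rewrite mul1r (@omega_sqr1 K phi d s s2 k d14 dE).
  by exists d; rewrite mul0r add0r omega_id // -expr2.
(* The existence of P forces f to divide the discriminant of K. *)
have ram : (f %| d)%Z \/ f = 2%N /\ (d != 1 %[mod 4])%Z.
  have [x [Px nx x2]] := exists_sqr_in_dilate D1 f0 idP nP P2.
  have Dx : D x by case: idP => + _ _ _; apply.
  have free_w : Zfree 1 (omega d s).
    have [d14|nd14] := boolP (d == 1 %[mod 4])%Z; last first.
      by rewrite omega_id //; exact: (@sqrt_free K phi d s sf d1 s2).
    apply: (@Zfree_affine K phi d s sf d1 s2 _ 2 (-1)) => //.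
    by rewrite (@omega_double K phi) //; ring.
  rewrite DE in Dx nx x2.
  exact: ramified_divides pf free_w wk dk Dx nx x2.
have [pi [j [T [N [c [e [piE pi2 [fT fN nfN] [sE cf] eE]]]]]]] :=
  @exists_eisenstein_generator K phi d s sf d1 s2 f pf ram.
have c0 : c != 0.
  apply: contraTneq cf => ->; rewrite prime_coprimez // negbK.
  by rewrite dvdz0.
have fr : Zfree 1 pi := @Zfree_affine K phi d s sf d1 s2 pi c e c0 sE.
have {}DE : D = Zspan 1 pi by rewrite DE piE -[X in _ + X]mulr1 Zspan_shift.
have OE : O = Zspan 1 (f%:R * pi).
  rewrite /O (@ZadjoinE K _ (f%:Z * (d == 1 %[mod 4])%Z%:R) (f%:Z ^+ 2 * k)).
    by rewrite piE mulrDr -[X in _ + X]mulr1 -[f%:R * j%:~R]/(f%:~R * j%:~R)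
      -intrM Zspan_shift.
  by rewrite mulrACA wk; ring.
have PE : P = Zspan (f%:R : K) pi 
  by move: prP P2; rewrite DE; apply: (ramified_primeE pf pi2 fT fN).
rewrite /F; clearbody D O; subst D O P.
have e5 := ideal_exp5 (order1 pi) idP P2.
have e4 := ideal_exp4 (order1 pi) idP P2.
have P4E (h : K) (c' e' : int) : coprimez c' f -> h = c'%:~R * pi + e'%:~R ->
    gen2 (Zspan 1 (f%:R * pi)) (f%:R ^+ 2) (f%:R ^+ 2 * h)
      = ideal_exp (Zspan 1 pi) (Zspan f%:R pi) 4.
  by move=> cf' ->; rewrite (gen2_f2D pi2) // e4.
have cop1 : coprimez 1 f by rewrite coprimezE coprime1n.
(* s lies in P outside the exceptional case, where 1 + s does. *)
have main_gen : ~ (f = 2%N /\ (d = 3 %[mod 4])%Z) ->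
    exists q : int, s = c%:~R * pi + q%:~R * f%:R.
  move=> nexc; move: eE; case: ifP => [/andP[/eqP f2 /eqP d3]|_ /dvdzP[q qE]].
    by case: nexc.
  by exists q; rewrite sE qE; ring.
have exc_gen : f = 2%N /\ (d = 3 %[mod 4])%Z -> 1 + s = pi.
  by move=> [f2 /eqP d3]; move: eE; rewrite f2 d3.
split.
- split=> [h|[d3 f2]].
    have [|q {1}->] := main_gen; last by rewrite (gen2_P pi2 fT fN).
    by move=> [f2 d3]; case: h => [|[|[_]]] //; rewrite d3.
  have := gen2_P pi2 fT fN 0 cop1.
  by rewrite exc_gen // mul1r mul0r addr0 f2.
- by move=> Q; exact: (basic_primary_between pf fr pi2 fT fN nfN idP P2).
- rewrite sE (gen2_fO f pi2) //; split=> // Q.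
  exact: (ideals_F_F2 pf fr pi2).
split=> [|nexc|exc].
- exact: e5.
- have [q qE] := main_gen nexc; split.
  + by rewrite (conductorE f fr pi2) (P4E _ _ _ cf sE) e4.
  + by rewrite (conductorE f fr pi2) e4.
  + move=> Q idQ Q3 Q5; rewrite (P4E _ _ _ cf sE).
    by rewrite {1}qE; apply: (ideals_P3_P5 pf fr).
have sE' : 1 + s = 1%:~R * pi + 0%:~R by rewrite (exc_gen exc) mul1r addr0.
have sq2 : (f%:R : K) ^+ 2 = 4 by rewrite (proj1 exc); ring.
have cube2 : (f%:R : K) ^+ 3 = 8 by rewrite (proj1 exc); ring.
have e4' := P4E _ _ _ cop1 sE'; rewrite sq2 in e4'.
split=> // Q idQ Q3 Q5; rewrite e4'.
have := ideals_P3_P5 pf fr 0 idP P2 cop1 idQ Q3 Q5.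
rewrite sq2 cube2 mul1r mul0r addr0 -(exc_gen exc).
case=> [[a a_lt ->]|->]; last by constructor 3.
rewrite (proj1 exc) in a_lt *.
case: a a_lt => [|[|//]] _.
  by constructor 1; rewrite mul0r add0r.
by constructor 2; rewrite mul1r.
Qed.
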